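(* Let $A=A(\theta)\in\mathbb{R}^{(s+k)\times(s+l)}$ be a matrix (the pre-array) whose entries are known differentiable functions of a scalar real parameter $\theta$. Consider, for each $\theta$, the equation $QA=R$ with the partitioning $$Q\begin{bmatrix}A_{11}&A_{12}\\ A_{21}&A_{22}\end{bmatrix}=\begin{bmatrix}R_{11}&R_{12}\\ 0&R_{22}\end{bmatrix},$$ where the block rows have sizes $s$ and $k$ (from top to bottom), the block columns have sizes $s$ and $l$ (from left to right), $Q=Q(\theta)\in\mathbb{R}^{(s+k)\times(s+k)}$ is an orthogonal matrix that produces the block zero entry on the right-hand side, and $R_{11}=R_{11}(\theta)\in\mathbb{R}^{s\times s}$ is upper triangular. Assume that $R_{11}$ is invertible and that the blocks $R_{11},R_{12}$ are differentiable in $\theta$. Define blocks $X,N,Y,V$ by $$Q\begin{bmatrix}(A_{11})'_\theta&(A_{12})'_\theta\\ (A_{21})'_\theta&(A_{22})'_\theta\end{bmatrix}=\begin{bmatrix}X&N\\ Y&V\end{bmatrix},$$ with the same block sizes (block rows $s$, $k$; block columns $s$, $l$). Then, given the derivative $A'_\theta$ of the pre-array, the derivatives of the blocks $R_{11}$ and $R_{12}$ of the post-array are $$(R_{11})'_\theta=\bigl(\bar{\mathcal L}^T+\mathcal D+\bar{\mathcal U}\bigr)R_{11},$$ $$(R_{12})'_\theta=\bigl[\bar{\mathcal L}^T-\bar{\mathcal L}\bigr]R_{12}+R_{11}^{-T}Y^TR_{22}+N,$$ where $\bar{\mathcal L}$, $\mathcal D$ and $\bar{\mathcal U}$ are respectively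 the strictly lower triangular, diagonal and strictly upper triangular parts of the matrix product $XR_{11}^{-1}$.
   Context: $(\cdot)'_\theta$ denotes the entrywise derivative with respect to $\theta$. $M^{-T}=(M^{-1})^T$. Blocks with zero rows (e.g. when $k=0$) are understood as empty, and terms involving them vanish. Every square matrix $M$ splits uniquely as $M=\bar{\mathcal L}+\mathcal D+\bar{\mathcal U}$ with $\bar{\mathcal L}$ strictly lower triangular, $\mathcal D$ diagonal and $\bar{\mathcal U}$ strictly upper triangular. *)

(* Defs.v *)
From HB Require Import structures.
From mathcomp Require Export all_boot all_order all_algebra.
From mathcomp Require Export all_classical all_reals all_analysis.
Export Order.TTheory GRing.Theory Num.Theory.
Export numFieldNormedType.Exports.

Set Implicit Arguments.
Unset Strict Implicit.
Unset Printing Implicit Defensive.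

Local Open Scope ring_scope.

Definition strict_lower_part (R : realType) (n : nat) (M : 'M[R]_n) : 'M[R]_n :=
  \matrix_(i, j) if (j < i)%N then M i j else 0.

Definition diag_part (R : realType) (n : nat) (M : 'M[R]_n) : 'M[R]_n :=
  \matrix_(i, j) if i == j then M i j else 0.

Definition strict_upper_part (R : realType) (n : nat) (M : 'M[R]_n) : 'M[R]_n :=
  \matrix_(i, j) if (i < j)%N then M i j else 0.

(* [is_trig_mx] means lower triangular. *)
Definition upper_triangular (R : realType) (n : nat) (M : 'M[R]_n) : bool :=
  is_trig_mx M^T.

Definition orthogonal_matrix (R : realType) (n : nat) (M : 'M[R]_n) : Prop :=
  M^T *m M = 1%:M.

Lemma derive1_entrywise (R : realType) (m n : nat) (F : R -> 'M[R]_(m, n))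
    (theta : R) :
  (forall i j, derivable (fun t : R => F t i j) theta 1) ->
  derivable F theta 1 /\
  F^`()%classic theta =
    \matrix_(i, j) (fun t : R => F t i j)^`()%classic theta.
Proof.
move=> /derivable_mxP dF; split; first exact: dF.
rewrite derive1E derive_mx//; apply/matrixP => i j.
by rewrite !mxE derive1E.
Qed.

(* Main.v *)
(* The factor [Q] need not be differentiable, so it is eliminated first: since
   [Q] is orthogonal, [A^T A = P^T P] with [P] the post-array.
   Differentiating the blocks (1,1) and (1,2) of this identity and writing
   [W = R11' R11^-1], [M = X R11^-1] gives [W^T + W = M^T + M] and
   [R12' = (M^T - W^T) R12 + R11^-T Y^T R22 + N]. As [W] is upper triangular,
   the first equation determines it, and then [M^T - W^T = W - M = L^T - L]. *)
Require Import Defs.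

Set Implicit Arguments.
Unset Strict Implicit.
Unset Printing Implicit Defensive.

Local Open Scope ring_scope.

Lemma derivable_coord (R : realType) (m n : nat) (F : R -> 'M[R]_(m, n))
    (x : R) i j :
  derivable F x 1 -> derivable (fun t => F t i j) x 1.
Proof. by move=> /derivable_mxP; apply. Qed.

Lemma derive1_mxE (R : realType) (m n : nat) (F : R -> 'M[R]_(m, n))
    (x : R) i j :
  derivable F x 1 ->
  F^`()%classic x i j = (fun t => F t i j)^`()%classic x.
Proof. by move=> dF; rewrite derive1E derive_mx// mxE derive1E. Qed.

(** Product rule for single entries: [R22] is not assumed differentiable, so the Gram matrix of the
    post-array is differentiated only through entries of its upper blocks. *)
Lemma derive1_trmx_mulmx_coord (R : realType) (m n p : nat)
    (F : R -> 'M[R]_(m, n)) (G : R -> 'M[R]_(m, p)) (x : R) i j :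
  derivable F x 1 -> derivable G x 1 ->
  (fun t => ((F t)^T *m G t) i j)^`()%classic x =
  ((F^`()%classic x)^T *m G x + (F x)^T *m G^`()%classic x) i j.
Proof.
move=> dF dG.
have -> : (fun t => ((F t)^T *m G t) i j) =
          \sum_(h < m) ((fun t => F t h i) * (fun t => G t h j)).
  by apply/funext => t; rewrite fct_sumE mxE; apply: eq_bigr => h _; rewrite mxE.
have dFG h : derivable ((fun t => F t h i) * (fun t => G t h j)) x 1.
  by apply: derivableM; apply: derivable_coord.
rewrite derive1E derive_sum// !mxE -big_split/=; apply: eq_bigr => h _.
rewrite deriveM; [|exact: derivable_coord..].
rewrite !mxE !derive1_mxE// !derive1E addrC.
(* [deriveM] produces scalings [*:], which on the field [R] are products by conversion. *)
by congr (_ + _); rewrite -[LHS]/(_ * _) mulrC.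
Qed.

Lemma derive1_upper_triangular (R : realType) (n : nat) (F : R -> 'M[R]_n)
    (x : R) :
  (forall t, upper_triangular (F t)) -> derivable F x 1 ->
  upper_triangular (F^`()%classic x).
Proof.
move=> uF dF; apply/is_trig_mxP => i j ij; rewrite mxE derive1_mxE//.
have -> : (fun t => F t j i) = cst 0.
  by apply/funext => t; have /is_trig_mxP/(_ i j ij) := uF t; rewrite mxE.
by rewrite derive1_cst.
Qed.

(** Columns of [W] are cleared from left to right. For [j < i], in the entry [(i, j)] of [W *m T]
    the terms [h < j] vanish by induction and the terms [h > j] because [T] is triangular. What
    remains is [W i j * T j j], with [T j j] nonzero. *)
Lemma upper_triangular_mulmxr_cancel (R : realType) (n : nat)
    (W T : 'M[R]_n) :
  T \in unitmx -> upper_triangular T -> upper_triangular (W *m T) ->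
  upper_triangular W.
Proof.
move=> uT trT /is_trig_mxP trWT.
have T_diag i : T i i != 0.
  move: uT; rewrite unitmxE unitfE -det_tr det_trig//.
  by move=> /prodf_neq0/(_ i isT); rewrite mxE.
have T_low (i j : 'I_n) : (i < j)%N -> T j i = 0.
  by move=> ij; have /is_trig_mxP/(_ i j ij) := trT; rewrite mxE.
(* [m] bounds the column index, so that plain induction on [m] covers all columns to the left of
   [j]. *)
suff W_low m (j i : 'I_n) : (j < m)%N -> (j < i)%N -> W i j = 0.
  by apply/is_trig_mxP => j i ji; rewrite mxE (W_low j.+1).
elim: m j i => // m IHm j i jm ji.
have := trWT j i ji; rewrite !mxE (bigD1 j)//= big1 ?addr0 => [|h hj].
  by move=> /eqP; rewrite mulf_eq0 (negPf (T_diag j)) orbF => /eqP.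
case: (ltngtP h j) => [hj'|jh|/val_inj hj']; last by rewrite hj' eqxx in hj.
  by rewrite IHm ?mul0r//; [exact: leq_trans hj' _|exact: ltn_trans ji].
by rewrite T_low// mulr0.
Qed.

(** Above the diagonal [W^T] vanishes, so [W i j = M j i + M i j]. On the diagonal both sides of the
    equation are doubled entries, and 2 cancels. *)
Lemma upper_triangular_symmetrization (R : realType) (n : nat)
    (W M : 'M[R]_n) :
  upper_triangular W -> W^T + W = M^T + M ->
  W = (strict_lower_part M)^T + diag_part M + strict_upper_part M.
Proof.
move=> /is_trig_mxP uW /matrixP WM; apply/matrixP => i j.
have := WM i j; rewrite !mxE -val_eqE/=.
case: (ltngtP i j) => [ij|ji|/val_inj <-].
- by have := uW i j ij; rewrite mxE => ->; rewrite add0r addr0.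
- by have := uW j i ji; rewrite mxE => -> _; rewrite !addr0.
- by rewrite -!mulr2n => /(@pmulrnI _ 2%N isT); rewrite add0r addr0.
Qed.

Lemma mx_parts_decomp (R : realType) (n : nat) (M : 'M[R]_n) :
  M = strict_lower_part M + diag_part M + strict_upper_part M.
Proof.
apply/matrixP => i j; rewrite !mxE -val_eqE/=.
by case: ltngtP => _; rewrite ?addr0 ?add0r.
Qed.

Theorem lemma2 (R : realType) (s k l : nat)
  (A : R -> 'M[R]_(s + k, s + l)) (Q : R -> 'M[R]_(s + k))
  (R11 : R -> 'M[R]_s) (R12 : R -> 'M[R]_(s, l)) (R22 : R -> 'M[R]_(k, l))
  (X : R -> 'M[R]_s) (N : R -> 'M[R]_(s, l))
  (Y : R -> 'M[R]_(k, s)) (V : R -> 'M[R]_(k, l))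
  (A_derivable : forall theta : R, derivable A theta 1)
  (Q_orthogonal : forall theta : R, orthogonal_matrix (Q theta))
  (QA_eq : forall theta : R,
     Q theta *m A theta = block_mx (R11 theta) (R12 theta) 0 (R22 theta))
  (R11_upper : forall theta : R, upper_triangular (R11 theta))
  (R11_unit : forall theta : R, R11 theta \in unitmx)
  (R11_derivable : forall theta : R, derivable R11 theta 1)
  (R12_derivable : forall theta : R, derivable R12 theta 1)
  (QdA_eq : forall theta : R,
     Q theta *m A^`()%classic theta =
     block_mx (X theta) (N theta) (Y theta) (V theta)) :
  forall theta : R,
    let M := X theta *m invmx (R11 theta) in
    let L := strict_lower_part M in
    let D := diag_part M in
    let U := strict_upper_part M in
    R11^`()%classic theta = (L^T + D + U) *m R11 theta /\
    R12^`()%classic theta =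
      (L^T - L) *m R12 theta
      + (invmx (R11 theta))^T *m (Y theta)^T *m R22 theta + N theta.
Proof.
move=> x M L D U.
set P := fun t => block_mx (R11 t) (R12 t) 0 (R22 t).
have gram t : (A t)^T *m A t = (P t)^T *m P t.
  by rewrite /P -QA_eq trmx_mul mulmxA -(mulmxA _ _ (Q t)) Q_orthogonal mulmx1.
set dA := A^`()%classic x; set Z := block_mx (X x) (N x) (Y x) (V x).
(* The left side is the derivative of [A^T A]. Since [P = Q A] and [Z = Q A'], each [Q^T Q] on the
   right collapses, and no derivative of [Q] occurs. *)
have dgram : dA^T *m A x + (A x)^T *m dA = Z^T *m P x + (P x)^T *m Z.
  rewrite /Z /P -QA_eq -QdA_eq !trmx_mul !mulmxA.
  by rewrite -!(mulmxA _ _ (Q x)) Q_orthogonal !mulmx1.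
set dR11 := R11^`()%classic x; set dR12 := R12^`()%classic x.
have ZPE : Z^T *m P x + (P x)^T *m Z =
    block_mx ((X x)^T *m R11 x + (R11 x)^T *m X x)
             ((X x)^T *m R12 x + (Y x)^T *m R22 x + (R11 x)^T *m N x)
             ((N x)^T *m R11 x + ((R12 x)^T *m X x + (R22 x)^T *m Y x))
             ((N x)^T *m R12 x + (V x)^T *m R22 x
              + ((R12 x)^T *m N x + (R22 x)^T *m V x)).
  rewrite /Z /P !tr_block_mx !mulmx_block add_block_mx.
  by rewrite trmx0 !mulmx0 !mul0mx !addr0.
have gramE t : (P t)^T *m P t =
    block_mx ((R11 t)^T *m R11 t) ((R11 t)^T *m R12 t)
             ((R12 t)^T *m R11 t)
             ((R12 t)^T *m R12 t + (R22 t)^T *m R22 t).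
  by rewrite /P tr_block_mx mulmx_block trmx0 !mulmx0 !mul0mx !addr0.
(* Each entry of [R11^T R11] is, as a function of the parameter, an entry of [A^T A]; its derivative
   is computed in both forms. *)
have E11 : dR11^T *m R11 x + (R11 x)^T *m dR11 =
           (X x)^T *m R11 x + (R11 x)^T *m X x.
  apply/matrixP => i j; rewrite -derive1_trmx_mulmx_coord//.
  have -> : (fun t => ((R11 t)^T *m R11 t) i j) =
            (fun t => ((A t)^T *m A t) (lshift l i) (lshift l j)).
    by apply/funext => t; rewrite gram gramE block_mxEul.
  by rewrite derive1_trmx_mulmx_coord// dgram ZPE block_mxEul.
have E12 : dR11^T *m R12 x + (R11 x)^T *m dR12 =
           (X x)^T *m R12 x + (Y x)^T *m R22 x + (R11 x)^T *m N x.
  apply/matrixP => i j; rewrite -derive1_trmx_mulmx_coord//.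
  have -> : (fun t => ((R11 t)^T *m R12 t) i j) =
            (fun t => ((A t)^T *m A t) (lshift l i) (rshift s j)).
    by apply/funext => t; rewrite gram gramE block_mxEur.
  by rewrite derive1_trmx_mulmx_coord// dgram ZPE block_mxEur.
have uR := R11_unit x; have uRT : (R11 x)^T \in unitmx by rewrite unitmx_tr.
pose W := dR11 *m invmx (R11 x).
have WR : W *m R11 x = dR11 by rewrite mulmxKV.
have MR : M *m R11 x = X x by rewrite mulmxKV.
have W_upper : upper_triangular W.
  apply: (upper_triangular_mulmxr_cancel uR) => //.
  by rewrite WR; exact: derive1_upper_triangular.
have W_sym : W^T + W = M^T + M.
  (* Multiplying by [R11^T] on the left and [R11] on the right turns the claim into [E11]. *)
  apply: (can_inj (mulKmx uRT)); apply: (can_inj (mulmxK uR)).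
  rewrite !mulmxDr !mulmxDl -!trmx_mul WR MR -(mulmxA _ W) -(mulmxA _ M) WR MR.
  exact: E11.
have W_parts : W = L^T + D + U := upper_triangular_symmetrization W_upper W_sym.
have skew : L^T - L = M^T - W^T.
  transitivity (W - M).
    rewrite W_parts [M in RHS]mx_parts_decomp -!(addrA _ D).
    by rewrite opprD addrACA subrr addr0.
  apply/eqP; rewrite subr_eq -addrA [_ + M]addrC addrA -W_sym.
  by rewrite addrAC addrN add0r.
split; first by rewrite -W_parts WR.
(* After multiplication by [R11^T], the identities [R11^T M^T = X^T] and [R11^T W^T = R11'^T] reduce
   the goal to [E12] with [R11'^T R12] moved across. *)
apply: (can_inj (mulKmx uRT)).
rewrite !mulmxDr skew trmx_inv !mulmxA mulmxV// mul1mx mulmxBr -!trmx_mul WR MR.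
rewrite mulmxBl; apply: (addrI (dR11^T *m R12 x)); rewrite E12.
by rewrite !addrA [_ + (X x)^T *m _]addrC addrK.
Qed.
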